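(* For bivalued instances, the Match&Freeze-and-RoundRobin algorithm (defined in the context) makes $O(\log n)$ value queries per agent and computes a $\frac12$-EFX allocation.
   Context: There is a set $N=\{1,\dots,n\}$ of $n\ge 2$ agents and a set $G$ of $m\ge n$ goods. Each agent $i$ has a valuation function $v_i:G\to\mathbb{R}_{\ge 0}$, extended additively to bundles: $v_i(X)=\sum_{g\in X}v_i(g)$ for $X\subseteq G$. The instance is bivalued if for every agent $i$ there are real numbers $h_i>\ell_i\ge 0$ (possibly different for different agents) such that $v_i(g)\in\{h_i,\ell_i\}$ for every $g\in G$; $h_i$ is the high value and $\ell_i$ the low value of agent $i$. An allocation is a tuple $(X_i)_{i\in N}$ of pairwise disjoint (possibly empty) bundles with $\bigcup_i X_i=G$. For $\alpha\in[0,1]$, an allocation is $\alpha$-EFX if for all agents $i\ne j$ with $X_j\ne\varnothing$ and every $g\in X_j$, $v_i(X_i)\ge\alpha\cdot v_i(X_j\setminus\{g\})$. The algorithm is given, for each agent $i$, a ranking (strict linear order) $\succ_i$ of $G$ consistent with the unknown $v_i$, i.e., $g\succ_i g'$ implies $v_i(g)\ge v_i(g')$. It may make value queries, each of which names an agent $i$ and a good $g$ and returns $v_i(g)$. The Match&Freeze-and-RoundRobin algorithm works as follows. Initialization: for each agent $i$, perform a binary search (using value queries) over the $n$ top-ranked goods of $\succ_i$ for two consecutive goods $g,g'$ with $v_i(g)>v_i(g')$. If the search succeeds (in which case the whole function $v_i$ is known, since there are only two values), put $i$ in a set $M$ and set a freeze counter $F_i=0$. Otherwise (all top-$n$ goods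 have the same value for $i$), put $i$ in a set $R$. Set $X_i=\varnothing$ for all $i$, and let the pool of available goods be $P=G$. Phases: while $P\ne\varnothing$, repeat the following two steps. (a) One round of Match&Freeze for the agents of $M$: for each $i\in M$, if $F_i>0$ then decrease $F_i$ by $1$ (the agent is frozen in this phase); otherwise put $i$ in the set $U$ of unfrozen agents of this phase. Compute a maximum matching $\mu$ between the agents of $U$ and the available goods they value as high; the matching is prioritized, in that if not all agents of $U$ can be matched, agents with a higher ratio $h_i/\ell_i$ of high to low value are given priority in a maximum-cardinality matching. Each agent $i$ matched in $\mu$ is given the good $\mu(i)$, which is removed from $P$. Then, for each agent $i\in U$ not matched in $\mu$, if $P\ne\varnothing$: give $i$ an arbitrary good of $P$, remove it from $P$, and for every agent $j$ matched in $\mu$ with $v_i(\mu(j))=h_i$ set $F_j=\lfloor h_i/\ell_i-1\rfloor$. (b) One round of Round Robin for the agents of $R$: one by one, in a fixed order, each agent $i\in R$ is given (if $P\ne\varnothing$) her top-ranked good in $P$ according to $\succ_i$, and this good is removed from $P$. When $P=\varnothing$, return $(X_i)_{i\in N}$.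
   Formalization: When several unmatched agents i freeze the same j in one phase, F_j is set to the maximum of their values ⌊h_i/ℓ_i−1⌋ instead of being overwritten; with overwriting in arbitrary order 1/2-EFX fails (3 agents, ratios 20, 10, 2, 6 goods, one common high good). For ℓ_i=0 the duration is infinite. *)

(* Defs.v *)
From HB Require Import structures.
From mathcomp Require Import all_boot all_order all_algebra.
From mathcomp Require Import reals constructive_ereal.
From mathcomp Require Import exp.

Set Implicit Arguments.
Unset Strict Implicit.
Unset Printing Implicit Defensive.

Import Order.TTheory GRing.Theory Num.Theory.

Local Open Scope ring_scope.

(** * Fair division instances *)

Section Instances.
Variables (R : realType) (n : nat) (G : finType).

Definition bundle_value (v : 'I_n -> G -> R) (i : 'I_n) (X : {set G}) : R :=
  \sum_(g in X) v i g.

Definition bivalued (v : 'I_n -> G -> R) : Prop :=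
  forall i, exists h l : R,
    [/\ 0 <= l, l < h & forall g, v i g = h \/ v i g = l].

Definition is_allocation (X : 'I_n -> {set G}) : Prop :=
  (forall i j, i != j -> [disjoint X i & X j]) /\ \bigcup_i X i = [set: G].

Definition is_EFX (alpha : R) (v : 'I_n -> G -> R) (X : 'I_n -> {set G}) : Prop :=
  forall i j, i != j -> X j != set0 -> forall g, g \in X j ->
    alpha * bundle_value v i (X j :\ g) <= bundle_value v i (X i).

(** [pref i g g'] reads "agent [i] ranks [g] strictly above [g']". *)
Definition strict_linear_order (r : rel G) : Prop :=
  [/\ irreflexive r, transitive r & forall g g', g != g' -> r g g' || r g' g].

Definition consistent_rankings (v : 'I_n -> G -> R) (pref : 'I_n -> rel G) : Prop :=
  forall i g g', pref i g g' -> v i g' <= v i g.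

(** The goods from best to worst.  The reflexive closure is used because
    [sort] expects a total relation. *)
Definition ranking (r : rel G) : seq G :=
  sort [rel g g' | (g == g') || r g g'] (enum G).

End Instances.

(** * Computations with value queries

    A [querying A] has no access to the valuations except through [Ask]. *)

Inductive querying (R : Type) (n : nat) (G A : Type) : Type :=
| Ret of A
| Ask of 'I_n & G & (R -> querying R n G A).

Arguments Ret {R n G A} _.
Arguments Ask {R n G A} _ _ _.

Fixpoint bind R n G A B (c : querying R n G A) (f : A -> querying R n G B)
    : querying R n G B :=
  match c with
  | Ret a => f a
  | Ask i g k => Ask i g (fun x => bind (k x) f)
  end.

(** The result, together with the list of all queries made, counted with
    repetitions. *)
Fixpoint run R n G A (v : 'I_n -> G -> R) (c : querying R n G A)
    : A * seq ('I_n * G) :=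
  match c with
  | Ret a => (a, [::])
  | Ask i g k => let p := run v (k (v i g)) in (p.1, (i, g) :: p.2)
  end.

Definition queries_of n (G : Type) (i : 'I_n) (qs : seq ('I_n * G)) : nat :=
  count (fun q => q.1 == i) qs.

(** * Initialization *)

(** What a successful binary search reveals about a bivalued agent. *)
Record knowledge (R : Type) (G : finType) :=
  Knowledge { high_goods : {set G}; high : R; low : R }.

Section Initialization.
Variables (R : realType) (n : nat) (G : finType).
Implicit Types (i : 'I_n) (s : seq G).

(** Binary search between the positions [lo < hi] of [s], whose goods are known
    to have the values [a > b]; it returns a position [k] and the values of the
    goods at positions [k] and [k.+1], the first of which is larger.  As
    [hi - lo] decreases at each call, [fuel := size s] never runs out. *)
Fixpoint bisect i (g0 : G) s (fuel lo hi : nat) (a b : R)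
    : querying R n G (nat * R * R) :=
  if fuel is fuel'.+1 then
    if (lo.+1 < hi)%N then
      let mid := (lo + hi)./2 in
      Ask i (nth g0 s mid) (fun c =>
        if c < a then bisect i g0 s fuel' lo mid a c
        else bisect i g0 s fuel' mid hi c b)
    else Ret (lo, a, b)
  else Ret (lo, a, b).

(** [None] when the first and the last good of [s] have the same value. *)
Definition search i s : querying R n G (option (nat * R * R)) :=
  if s is g0 :: _ then
    Ask i g0 (fun a => Ask i (last g0 s) (fun b =>
      if b < a then
        bind (bisect i g0 s (size s) 0 (size s).-1 a b) (fun p => Ret (Some p))
      else Ret None))
  else Ret None.

(** The agent values as high exactly the goods ranked down to position [k]. *)
Definition learn (r : rel G) (p : nat * R * R) : knowledge R G :=
  let: (k, a, b) := p in
  Knowledge [set g in take k.+1 (ranking r)] a b.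

Fixpoint learn_all (pref : 'I_n -> rel G) (agents : seq 'I_n)
    (K : 'I_n -> option (knowledge R G))
    : querying R n G ('I_n -> option (knowledge R G)) :=
  if agents is i :: agents' then
    bind (search i (take n (ranking (pref i)))) (fun o =>
      learn_all pref agents'
        (fun j => if j == i then omap (learn (pref i)) o else K j))
  else Ret K.

(** In the result [K], the set M consists of the agents [i] for which [K i] is
    some [k], and R of the other agents. *)
Definition initialization (pref : 'I_n -> rel G)
    : querying R n G ('I_n -> option (knowledge R G)) :=
  learn_all pref (enum 'I_n) (fun=> None).

End Initialization.

(** * Phases

    The choices left open by the algorithm (which prioritized matching, in
    which order the unmatched agents are served, which available goods they
    get) are nondeterministic, so that a phase is a relation between states. *)

(** Freeze counters may be infinite, because low values may be zero. *)
Record state (n : nat) (G : finType) := State {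
  bundles : 'I_n -> {set G};
  pool : {set G};
  freeze : 'I_n -> \bar int
}.

Section Phases.
Variables (R : realType) (n : nat) (G : finType).
Variable K : 'I_n -> option (knowledge R G).
Variable pref : 'I_n -> rel G.
Implicit Types (i j : 'I_n) (g : G) (s : state n G).
Implicit Types (mu : {ffun 'I_n -> option G}) (U : {set 'I_n}) (P : {set G}).

Definition initial_state : state n G :=
  State (fun=> set0) [set: G] (fun=> 0%E).

Definition in_M i : bool := isSome (K i).

Definition high_of i : {set G} := if K i is Some k then high_goods k else set0.

(** The ratio is [+oo] when the low value is zero, as [0^-1 = +oo] in [\bar R].
    It is only used for agents in M; other agents get a dummy value. *)
Definition value_ratio i : \bar R :=
  if K i is Some k then ((high k)%:E / (low k)%:E)%E else 0%E.

Definition matched mu : {set 'I_n} := [set i | isSome (mu i)].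

Definition is_matching U P mu : Prop :=
  (forall i g, mu i = Some g -> [/\ i \in U, g \in P & g \in high_of i]) /\
  (forall i j g, mu i = Some g -> mu j = Some g -> i = j).

Definition matched_at_ratio mu (r : \bar R) : nat :=
  #|[set i in matched mu | value_ratio i == r]|.

(** Lexicographic comparison, from the highest ratio downwards, of the numbers
    of matched agents having a given ratio. *)
Definition higher_priority mu' mu : Prop :=
  exists r : \bar R, (matched_at_ratio mu r < matched_at_ratio mu' r)%N /\
    forall r' : \bar R, (r < r')%E ->
      matched_at_ratio mu r' = matched_at_ratio mu' r'.

Definition maximum_matching U P mu : Prop :=
  is_matching U P mu /\
  forall mu', is_matching U P mu' -> (#|matched mu'| <= #|matched mu|)%N.

Definition prioritized_matching U P mu : Prop :=
  maximum_matching U P mu /\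
  forall mu', maximum_matching U P mu' -> ~ higher_priority mu' mu.

Definition give i g s : state n G :=
  State (fun j => if j == i then g |: bundles s j else bundles s j)
        (pool s :\ g) (freeze s).

Definition give_matched mu s : state n G :=
  State (fun i => if mu i is Some g then g |: bundles s i else bundles s i)
        (pool s :\: [set g | [exists i, mu i == Some g]]) (freeze s).

Definition unfrozen s : {set 'I_n} :=
  [set i | in_M i & ~~ (0 < freeze s i)%E].

Definition decrease_counters s : state n G :=
  State (bundles s) (pool s)
    (fun i => if in_M i && (0 < freeze s i)%E then (freeze s i - 1)%E
              else freeze s i).

Definition freeze_duration i : \bar int := er_map Num.floor (value_ratio i - 1)%E.

(** If several unmatched agents freeze the same [j] in a phase, the longest
    duration applies, whatever the order in which they are served: letting a
    later agent of smaller ratio shorten it would break 1/2-EFX.  When no two of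
    them freeze the same [j], or when they are served by nondecreasing ratio,
    this is plain assignment, since the counter of a matched agent is [0] at the
    beginning of the phase. *)
Definition freeze_for mu i s : state n G :=
  State (bundles s) (pool s)
    (fun j => if mu j is Some g then
                if g \in high_of i then maxe (freeze s j) (freeze_duration i)
                else freeze s j
              else freeze s j).

Inductive serve_unmatched mu : seq 'I_n -> state n G -> state n G -> Prop :=
| serve_nil s : serve_unmatched mu [::] s s
| serve_empty i agents s s' :
    pool s = set0 ->
    serve_unmatched mu agents s s' ->
    serve_unmatched mu (i :: agents) s s'
| serve_give i agents g s s' :
    g \in pool s ->
    serve_unmatched mu agents (freeze_for mu i (give i g s)) s' ->
    serve_unmatched mu (i :: agents) s s'.

Definition match_and_freeze s s' : Prop :=
  exists mu (order : seq 'I_n),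
    [/\ prioritized_matching (unfrozen s) (pool s) mu,
        perm_eq order (enum (unfrozen s :\: matched mu)) &
        serve_unmatched mu order (give_matched mu (decrease_counters s)) s'].

Definition top_ranked i P g : Prop :=
  g \in P /\ forall g', g' \in P -> g' != g -> pref i g g'.

Inductive round_robin : seq 'I_n -> state n G -> state n G -> Prop :=
| rr_nil s : round_robin [::] s s
| rr_empty i agents s s' :
    pool s = set0 ->
    round_robin agents s s' ->
    round_robin (i :: agents) s s'
| rr_give i agents g s s' :
    top_ranked i (pool s) g ->
    round_robin agents (give i g s) s' ->
    round_robin (i :: agents) s s'.

Variable rr_order : seq 'I_n.

Definition phase s s' : Prop :=
  exists s1, match_and_freeze s s1 /\
    round_robin [seq i <- rr_order | ~~ in_M i] s1 s'.

(** Total correctness of the loop "while the pool is nonempty, do a phase":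
    from [s], every execution terminates, never gets stuck, and returns bundles
    that satisfy [Q]. *)
Inductive always_returns (Q : ('I_n -> {set G}) -> Prop) : state n G -> Prop :=
| returns_now s :
    pool s = set0 -> Q (bundles s) -> always_returns Q s
| returns_later s :
    pool s != set0 ->
    (exists s', phase s s') ->
    (forall s', phase s s' -> always_returns Q s') ->
    always_returns Q s.

End Phases.

Arguments initial_state {n G}.

(* Main.v *)
Require Import Defs.
From mathcomp Require Import all_boot all_order all_algebra.
From mathcomp Require Import reals constructive_ereal.
From mathcomp Require Import exp.
From mathcomp Require boolp.
From mathcomp Require Import zify lra.

Import Order.TTheory GRing.Theory Num.Theory.

Local Open Scope ring_scope.

Set Implicit Arguments.
Unset Strict Implicit.
Unset Printing Implicit Defensive.

(** Every agent receives at most one good per phase.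

    An agent of R gets a good of her highest value [a] in the first phase, since
    her [n] top goods have the same value and the others take at most [n - 1] of
    them.  Each good she gets later is at least as good as any good given to
    somebody else in the following phases, so nobody is ahead of her by more
    than [a], which is at most the value of her bundle.

    An agent [i] of M gets a high good in every phase until she is unmatched or
    frozen for the first time.  From then on no high good of hers is available,
    because the matching is maximum (in the case of freezing: also after giving
    the good of [i] to the agent who freezes her).  If she is unmatched, the
    others who got a high good in that phase are frozen while she gets
    [floor (h / l)] low goods, which make up for all but less than [l] of the
    difference.  If she is frozen, then by priority it is by an agent of at most
    her own ratio, so she loses at most [(h / l - 1) * l = h - l], while she
    already has a high good. *)

(** * Initialization *)

Section Queries.
Variables (R : realType) (n : nat) (G : finType) (v : 'I_n -> G -> R).

Lemma run_bind A B (c : querying R n G A) (f : A -> querying R n G B) :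
  run v (bind c f) = ((run v (f (run v c).1)).1,
                      (run v c).2 ++ (run v (f (run v c).1)).2).
Proof. by elim: c => [a|i g k IH] /=; [case: (run v (f a)) | rewrite IH]. Qed.

(** Whichever half is kept, its left end has the larger value: [c < a] on the left, [b < a <= c] on
    the right. Each call shortens the gap, so fuel [hi - lo] suffices. *)
Lemma bisect_result i g0 s fuel lo hi a b :
    (lo < hi <= lo + fuel)%N -> a = v i (nth g0 s lo) -> b = v i (nth g0 s hi) ->
    b < a ->
  exists k, [/\ (k < hi)%N,
    (run v (bisect i g0 s fuel lo hi a b)).1
      = (k, v i (nth g0 s k), v i (nth g0 s k.+1)) &
    v i (nth g0 s k.+1) < v i (nth g0 s k)].
Proof.
elim: fuel lo hi a b => [|fuel IH] lo hi a b /=; first by lia.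
move=> lohi ea eb ltba; case: ifP => gap /=; last first.
  have eh : hi = lo.+1 by lia.
  by exists lo; rewrite -eh -ea -eb; split=> //; rewrite eh.
have ? : (lo < (lo + hi)./2 < hi)%N by lia.
case: ltP => c_a.
  have [||||k [? ? ?]] := IH lo (lo + hi)./2 a (v i (nth g0 s (lo + hi)./2)) => //.
    by lia.
  by exists k; split=> //; lia.
apply: IH => //; last exact: lt_le_trans c_a.
by lia.
Qed.

(** The gap, not the fuel, bounds the queries: both halves of a gap of at most [2 ^ q.+1] have a gap
    of at most [2 ^ q]. *)
Lemma bisect_queries i g0 s q fuel lo hi a b :
    (hi <= lo + 2 ^ q)%N ->
  let qs := (run v (bisect i g0 s fuel lo hi a b)).2 in
  (size qs <= q)%N && all (fun p => p.1 == i) qs.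
Proof.
elim: fuel q lo hi a b => [|fuel IH] [|q] lo hi a b //=; case: ifP => //= gap.
  by rewrite expn0; lia.
rewrite expnS eqxx ltnS => hi_le.
by case: ifP => _; apply: IH; lia.
Qed.

Variables (r : rel G) (i : 'I_n).
Hypothesis r_linear : strict_linear_order r.
Hypothesis v_mono : forall g g', r g g' -> v i g' <= v i g.

Lemma ranking_nth_le g0 p q :
  (p <= q < #|G|)%N -> v i (nth g0 (ranking r) q) <= v i (nth g0 (ranking r) p).
Proof.
move=> /andP[lepq ltq].
case: r_linear => irr tr tot.
set le := [rel g g' | (g == g') || r g g'].
have le_total : total le.
  by move=> x y /=; rewrite (eq_sym y); case: eqVneq => //= /tot.
have le_refl : reflexive le by move=> x /=; rewrite eqxx.
have le_trans : transitive le.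
  move=> y x z /= /orP[/eqP->//|xy] /orP[/eqP<-|yz]; first by rewrite xy orbT.
  by rewrite (tr _ _ _ xy yz) orbT.
have szr : size (ranking r) = #|G| by rewrite size_sort -cardE.
have /= := sorted_leq_nth le_trans le_refl g0 (sort_sorted le_total (enum G)).
move=> /(_ p q); rewrite !inE -/(ranking r) szr ltq (leq_ltn_trans lepq ltq).
by move=> /(_ isT isT lepq) /orP[/eqP->|/v_mono].
Qed.

Lemma mem_ranking g : g \in ranking r.
Proof. by rewrite mem_sort mem_enum. Qed.

Lemma uniq_ranking : uniq (ranking r).
Proof. by rewrite sort_uniq enum_uniq. Qed.

Lemma size_ranking : size (ranking r) = #|G|.
Proof. by rewrite size_sort -cardE. Qed.

End Queries.

(** The case [None] records that the [n] top goods share the maximum value: each is worth at least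
    as much as every good. *)
Definition learned (R : realType) (n : nat) (G : finType) (w : G -> R)
    (o : option (knowledge R G)) : Prop :=
  match o with
  | Some k => [/\ 0 <= low k, low k < high k &
      forall g, w g = if g \in high_goods k then high k else low k]
  | None => exists A : {set G}, #|A| = n /\
      forall g g', g \in A -> w g' <= w g
  end.

Local Arguments bisect : simpl never.

Section Initialization.
Variables (R : realType) (n : nat) (G : finType) (v : 'I_n -> G -> R).
Variable pref : 'I_n -> rel G.
Hypotheses (n_ge2 : (2 <= n)%N) (n_le : (n <= #|G|)%N).
Hypothesis v_bivalued : bivalued v.
Hypothesis pref_linear : forall i, strict_linear_order (pref i).
Hypothesis pref_consistent : consistent_rankings v pref.

Lemma search_queries i :
  let qs := (run v (search R i (take n (ranking (pref i))))).2 in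
  (size qs <= 2 + up_log 2 n)%N && all (fun p => p.1 == i) qs.
Proof.
set s := take n _; have szs : size s = n by rewrite size_takel ?size_ranking.
rewrite /search; case Es : s => [|g0 s'] //=.
case: ifP => _ /=; rewrite ?run_bind /= ?cats0 eqxx //=.
rewrite ltnS ltnS; apply: bisect_queries.
by have := up_logP n (isT : 1 < 2)%N; rewrite -szs Es /=; lia.
Qed.

Lemma search_learned i :
  learned n (v i)
    (omap (learn (pref i)) (run v (search R i (take n (ranking (pref i))))).1).
Proof.
set s := take n _; have szs : size s = n by rewrite size_takel ?size_ranking.
have szr := size_ranking (pref i).
have mono g0 p q := @ranking_nth_le _ _ _ v _ i (pref_linear i)
  (pref_consistent (i := i)) g0 p q.
rewrite /search; case Es : s => [|g0 s'] /=.
  by move: szs; rewrite Es /=; lia.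
have e0 : g0 = nth g0 (ranking (pref i)) 0.
  by rewrite -[LHS]/(nth g0 (g0 :: s') 0) -Es nth_take //; lia.
have el : last g0 s' = nth g0 (ranking (pref i)) n.-1.
  rewrite -[LHS]/(last g0 (g0 :: s')) -Es -nth_last szs nth_take //; lia.
case: ltP => [lt|ge] /=.
  rewrite run_bind /=.
  have [|||//|k [kn -> ltk]] := @bisect_result _ _ _ v i g0 (g0 :: s')
    (size s').+1 0 (size s') (v i g0) (v i (last g0 s')).
  - by move: szs; rewrite Es /=; lia.
  - by [].
  - by rewrite (last_nth g0).
  have kn1 : (k.+1 < n)%N by rewrite -szs Es /= ltnS.
  rewrite -Es !nth_take // in ltk *; last by lia.
  (* With only two values, the strict drop after position [k] identifies them as [h] and [l];
     monotonicity along the ranking then fixes all other values. *)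
  have [h [l [l0 lh hl]]] := v_bivalued i.
  have [vk vk1] : v i (nth g0 (ranking (pref i)) k) = h /\
                  v i (nth g0 (ranking (pref i)) k.+1) = l.
    move: ltk; case: (hl (nth g0 (ranking (pref i)) k)) => ->;
      case: (hl (nth g0 (ranking (pref i)) k.+1)) => -> //; rewrite ?ltxx //.
    by rewrite ltNge (ltW lh).
  split=> /=; rewrite ?vk ?vk1 // => g; rewrite inE.
  have gr : (index g (ranking (pref i)) < #|G|)%N.
    by rewrite -szr index_mem mem_ranking.
  have <- : nth g0 (ranking (pref i)) (index g (ranking (pref i))) = g.
    by rewrite nth_index ?mem_ranking.
  set p := index _ _ in gr *.
  rewrite in_take ?mem_nth ?szr // index_uniq ?uniq_ranking ?szr // ltnS.
  case: leqP => pk; case: (hl (nth g0 (ranking (pref i)) p)) => // vp.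
    by have: h <= l; [rewrite -vk -vp; apply: mono; lia | rewrite leNgt lh].
  by have: h <= l; [rewrite -vk1 -vp; apply: mono; rewrite pk | rewrite leNgt lh].
(* The search failed: the last of the [n] top goods is worth at least as much as the first, hence as
   much as any good. *)
exists [set g in s]; split.
  by rewrite cardsE; have /card_uniqP -> : uniq s by rewrite take_uniq ?uniq_ranking.
move=> g g'; rewrite inE => gs.
have gr : (index g' (ranking (pref i)) < #|G|)%N.
  by rewrite -szr index_mem mem_ranking.
have -> : g' = nth g0 (ranking (pref i)) (index g' (ranking (pref i))).
  by rewrite nth_index ?mem_ranking.
apply: le_trans (mono g0 0 _ gr) _; rewrite -e0 (le_trans ge) //.
have gn : (index g (ranking (pref i)) < n)%N by rewrite -in_take ?mem_ranking.
have -> : g = nth g0 (ranking (pref i)) (index g (ranking (pref i))).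
  by rewrite nth_index ?mem_ranking.
by rewrite el; apply: mono; lia.
Qed.

Lemma learn_all_spec agents K :
    uniq agents ->
  let p := run v (learn_all pref agents K) in
  (forall i, p.1 i = if i \in agents then
     omap (learn (pref i)) (run v (search R i (take n (ranking (pref i))))).1
     else K i) /\
  (forall i, queries_of i p.2 <= if i \in agents then 2 + up_log 2 n else 0)%N.
Proof.
elim: agents K => [|j agents IH] K //= /andP[jN uniq_agents].
rewrite run_bind /=; set c := search _ _ _.
have [IH1 IH2] := IH (fun j' => if j' == j then omap (learn (pref j))
  (run v c).1 else K j') uniq_agents.
split=> i.
  by rewrite IH1 inE; case: eqVneq => [->|//]; rewrite (negPf jN).
rewrite /queries_of count_cat inE; have := IH2 i; rewrite /queries_of.
have /andP[szc /allP allc] := search_queries j.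
case: eqVneq => [->|ij] /=; last first.
  rewrite (_ : count _ (run v c).2 = 0)%N //.
  apply/eqP; rewrite -leqn0 leqNgt -has_count; apply/hasPn => q /allc /eqP ->.
  by rewrite eq_sym.
rewrite (negPf jN) => h2.
by rewrite (leq_trans (leq_add (count_size _ _) h2)) ?addn0.
Qed.

(** As [2 ^ (up_log 2 n).-1 < n], all but three of the queries number at most [ln n / ln 2]; each of
    these three counts for one more such term since [2 <= n]. Hence the constant 4. *)
Lemma up_log_le_ln : (2 + up_log 2 n)%:R <= 4 / ln 2 * ln n%:R :> R.
Proof.
have ln2 : 0 < ln 2 :> R by rewrite ln_gt0 // ltr1n.
rewrite mulrAC ler_pdivlMr //.
have [ul1 ulh] : (0 < up_log 2 n)%N /\ (2 ^ (up_log 2 n).-1 < n)%N.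
  by split; [rewrite up_log_gt0; lia | exact: up_log_gtn].
have le1 : ln 2 <= ln n%:R :> R.
  by rewrite ler_ln ?posrE ?ler_nat ?ltr0n //; lia.
have le2 : ((up_log 2 n).-1)%:R * ln 2 <= ln n%:R :> R.
  rewrite mulr_natl -lnXn // ler_ln ?posrE ?exprn_gt0 ?ltr0n //; last by lia.
  by rewrite -natrX ler_nat ltnW.
have -> : (2 + up_log 2 n = 3 + (up_log 2 n).-1)%N by lia.
rewrite natrD mulrDl; lra.
Qed.

Lemma initialization_spec :
  let p := run v (initialization R pref) in
  (forall i, (queries_of i p.2)%:R <= 4 / ln 2 * ln n%:R :> R) /\
  (forall i, learned n (v i) (p.1 i)).
Proof.
have [h1 h2] := learn_all_spec (fun=> None) (enum_uniq 'I_n).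
split=> i; last by rewrite h1 mem_enum; apply: search_learned.
by have := h2 i; rewrite mem_enum => h; apply: le_trans up_log_le_ln; rewrite ler_nat.
Qed.

End Initialization.

(** * Outcome of a phase *)

Section Handouts.
Variables (n : nat) (G : finType).
Implicit Types (gift : 'I_n -> option G) (s : state n G).

(** A partial injection from agents to the pool of [s0]. The counters are left free, so that all
    steps of a phase add up to one [handout]. *)
Definition handout gift s0 s : Prop :=
  [/\ forall i, bundles s i =
        if gift i is Some g then g |: bundles s0 i else bundles s0 i,
      pool s = pool s0 :\: [set g | [exists i, gift i == Some g]],
      forall i g, gift i = Some g -> g \in pool s0 &
      forall i j g, gift i = Some g -> gift j = Some g -> i = j].

Lemma handout_mem_pool gift s0 s p : handout gift s0 s -> p \in pool s0 ->
  p \in pool s \/ exists i, gift i = Some p.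
Proof.
move=> [_ -> _ _] ps0; rewrite inE ps0 andbT inE.
by case: existsP => [[i /eqP]|]; [right; exists i | left].
Qed.

Lemma handout_gift_notin gift s0 s i g : handout gift s0 s -> gift i = Some g ->
  g \notin pool s.
Proof.
move=> [_ -> _ _] ig; rewrite inE inE negb_and negbK.
by apply/orP; left; apply/existsP; exists i; apply/eqP.
Qed.

Lemma handout_pool_sub gift s0 s : handout gift s0 s -> pool s \subset pool s0.
Proof. by move=> [_ -> _ _]; apply: subsetDl. Qed.

Lemma handout_give gift s0 s i g :
    handout gift s0 s -> gift i = None -> g \in pool s ->
  handout (fun j => if j == i then Some g else gift j) s0 (give i g s).
Proof.
move=> ho gi gs; have := ho; move=> [hb hp hg hi].
have gN j : gift j <> Some g by move=> /(handout_gift_notin ho); rewrite gs.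
split=> /=.
- by move=> j; rewrite hb; case: eqVneq => // ->; rewrite gi.
- rewrite hp; apply/setP => p; rewrite !inE.
  case: eqVneq => [->|pg] /=.
    apply/esym/negbTE; rewrite negb_and negbK; apply/orP; left; apply/existsP.
    by exists i; rewrite eqxx.
  congr (~~ _ && _); apply/existsP/existsP => [] [j gj]; exists j.
    by case: (eqVneq j i) gj => // ->; rewrite gi.
  by move: gj; case: (eqVneq j i) => // _ /eqP [ep]; rewrite ep eqxx in pg.
- move=> j p; case: eqVneq => [_ [<-]|_]; last exact: hg.
  exact: (subsetP (handout_pool_sub ho)).
- move=> j k p; case: eqVneq => [->|_]; case: eqVneq => [->|_] //; last exact: hi.
    by move=> [<-] /gN.
  by move=> + [ep]; rewrite -ep => /gN.
Qed.

End Handouts.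

Section Phase.
Variables (R : realType) (n : nat) (G : finType).
Variable K : 'I_n -> option (knowledge R G).
Variable pref : 'I_n -> rel G.
Implicit Types (s : state n G) (mu : {ffun 'I_n -> option G}).

Lemma serve_unmatched_pool_sub mu agents s s' :
  serve_unmatched K mu agents s s' -> pool s' \subset pool s.
Proof.
elim=> {agents s s'} [//|//|i agents g s s' _ _ /= h].
exact: subset_trans h (subsetDl _ _).
Qed.

(** The batch [gift] already handed out since [s0] is a parameter, so that this step can follow the
    matching. An agent is passed over only when the pool is empty, and it stays empty. *)
Lemma serve_unmatched_handout mu agents s s' :
    serve_unmatched K mu agents s s' -> uniq agents ->
  forall s0 gift, handout gift s0 s -> (forall i, i \in agents -> gift i = None) ->
  exists gift', [/\ handout gift' s0 s',
    forall i, i \notin agents -> gift' i = gift i &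
    forall i, i \in agents -> gift' i = None -> pool s' = set0].
Proof.
elim=> {agents s s'} [s|i agents s s' s0e ss' IH|i agents g s s' gs _ IH] /=.
- by move=> _ s0 gift ho _; exists gift.
- move=> /andP[iN uniq_agents] s0 gift ho gN.
  have [|gift' [ho' h1 h2]] := IH uniq_agents s0 gift ho.
    by move=> j ja; apply: gN; rewrite inE ja orbT.
  exists gift'; split=> // [j|j]; rewrite inE.
    by rewrite negb_or => /andP[_]; apply: h1.
  move=> /orP[_ _|]; last exact: h2.
  by apply/eqP; rewrite -subset0 -s0e (serve_unmatched_pool_sub ss').
- move=> /andP[iN uniq_agents] s0 gift ho gN.
  have gi : gift i = None by apply: gN; rewrite inE eqxx.
  have ho1 := handout_give ho gi gs.
  have [|gift' [ho' h1 h2]] := IH uniq_agents s0 _ ho1.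
    move=> j ja; case: (eqVneq j i) ja iN => [-> ->//|_ ja _].
    by apply: gN; rewrite inE ja orbT.
  exists gift'; split=> // [j|j]; rewrite inE.
    by rewrite negb_or => /andP[ji ja]; rewrite h1 // (negPf ji).
  by move=> /orP[/eqP ->|]; [rewrite h1 // eqxx | exact: h2].
Qed.

(** Because of [maxe], counters only grow: every duration applied remains a lower bound, and the
    final value is the old one or one of these durations. An agent who finds the pool empty freezes
    nobody, whence the alternative [pool s' = set0]. *)
Lemma serve_unmatched_freeze mu agents s s' :
    serve_unmatched K mu agents s s' ->
  [/\ forall j, (freeze s j <= freeze s' j)%E,
      forall j, mu j = None -> freeze s' j = freeze s j,
      forall i j g, i \in agents -> mu j = Some g -> g \in high_of K i ->
        pool s' = set0 \/ (freeze_duration K i <= freeze s' j)%E &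
      forall j, freeze s' j = freeze s j \/
        exists i g, [/\ i \in agents, mu j = Some g, g \in high_of K i &
          freeze s' j = freeze_duration K i]].
Proof.
elim=> {agents s s'} [s|i agents s s' s0e ss'|i agents g s s' gs _] /=.
- by split=> //; left.
- move=> [h1 h2 h3 h4]; split=> //.
    move=> i' j g _ _ _; left.
    by apply/eqP; rewrite -subset0 -s0e (serve_unmatched_pool_sub ss').
  move=> j; case: (h4 j) => [|[i' [g [ia mj gi e]]]]; first by left.
  by right; exists i', g; rewrite inE ia orbT.
- move=> [h1 h2 h3 h4]; split.
  + move=> j; apply: le_trans (h1 j); case: (mu j) => // p; case: ifP => // _.
    by rewrite le_max lexx.
  + by move=> j mj; rewrite h2 // mj.
  + move=> i' j p; rewrite inE => /orP[/eqP ->|]; last exact: h3.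
    move=> mj pi; right; apply: le_trans (h1 j); rewrite mj pi.
    by rewrite le_max lexx orbT.
  + move=> j; case: (h4 j) => [->|[i' [p [ia mj gi e]]]]; last first.
      by right; exists i', p; rewrite inE ia orbT.
    case mj: (mu j) => [p|]; last by left.
    case: ifP => pi; last by left.
    rewrite maxEle; case: ifP => _; [right | by left].
    by exists i, p; rewrite inE eqxx.
Qed.

Lemma round_robin_pool_sub agents s s' :
  round_robin pref agents s s' -> pool s' \subset pool s.
Proof.
elim=> {agents s s'} [//|//|i agents g s s' _ _ /= h].
exact: subset_trans h (subsetDl _ _).
Qed.

Lemma round_robin_freeze agents s s' :
  round_robin pref agents s s' -> freeze s' = freeze s.
Proof. by elim. Qed.

(** For the last clause: a good of the pool of [s0] is either still there when [i] chooses, so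
    ranked below her choice, or already given to somebody else. *)
Lemma round_robin_handout agents s s' :
    round_robin pref agents s s' -> uniq agents ->
  forall s0 gift, handout gift s0 s -> (forall i, i \in agents -> gift i = None) ->
  exists gift', [/\ handout gift' s0 s',
    forall i, i \notin agents -> gift' i = gift i,
    forall i, i \in agents -> gift' i = None -> pool s' = set0 &
    forall i g p, i \in agents -> gift' i = Some g -> p \in pool s0 -> p != g ->
      pref i g p \/ exists2 j, j != i & gift' j = Some p].
Proof.
elim=> {agents s s'} [s|i agents s s' s0e ss' IH|i agents g s s' [gs top] _ IH] /=.
- by move=> _ s0 gift ho _; exists gift.
- move=> /andP[iN uniq_agents] s0 gift ho gN.
  have [|gift' [ho' h1 h2 h3]] := IH uniq_agents s0 gift ho.
    by move=> j ja; apply: gN; rewrite inE ja orbT.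
  exists gift'; split=> // [j|j|j g p]; rewrite inE.
  + by rewrite negb_or => /andP[_]; apply: h1.
  + move=> /orP[_ _|]; last exact: h2.
    by apply/eqP; rewrite -subset0 -s0e (round_robin_pool_sub ss').
  + move=> /orP[/eqP->|]; last exact: h3.
    by rewrite h1 // gN // inE eqxx.
- move=> /andP[iN uniq_agents] s0 gift ho gN.
  have gi : gift i = None by apply: gN; rewrite inE eqxx.
  have ho1 := handout_give ho gi gs.
  have [|gift' [ho' h1 h2 h3]] := IH uniq_agents s0 _ ho1.
    move=> j ja; case: (eqVneq j i) ja iN => [-> ->//|_ ja _].
    by apply: gN; rewrite inE ja orbT.
  exists gift'; split=> // [j|j|j g' p]; rewrite inE.
  + by rewrite negb_or => /andP[ji ja]; rewrite h1 // (negPf ji).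
  + by move=> /orP[/eqP ->|]; [rewrite h1 // eqxx | exact: h2].
  + move=> /orP[/eqP->|]; last exact: h3.
    rewrite h1 // eqxx => [[<-]] ps0 pg.
    case: (handout_mem_pool ho ps0) => [ps|[k gk]]; first by left; apply: top.
    have ki : k != i by apply/eqP => ki; rewrite ki gi in gk.
    right; exists k => //; rewrite h1 ?(negPf ki) //.
    by apply/negP => ka; rewrite gN // inE ka orbT in gk.
Qed.

(** The invariants see a phase only through these facts. [outcome_freeze_ge] keeps the rivals of an
    unmatched agent frozen long enough; [outcome_freeze_le] limits what a frozen agent loses. *)
Record phase_outcome mu (gift : 'I_n -> option G) s s' : Prop := PhaseOutcome {
  outcome_matching : prioritized_matching K (unfrozen K s) (pool s) mu;
  outcome_handout : handout gift s s';
  outcome_matched : forall i g, mu i = Some g -> gift i = Some g;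
  outcome_frozen : forall i, in_M K i -> (0 < freeze s i)%E -> gift i = None;
  outcome_served : forall i, gift i = None ->
    pool s' = set0 \/ in_M K i && (0 < freeze s i)%E;
  outcome_round_robin : forall i g p, ~~ in_M K i -> gift i = Some g ->
    p \in pool s -> p != g -> pref i g p \/ exists2 j, j != i & gift j = Some p;
  outcome_freeze_unmatched : forall i, mu i = None ->
    freeze s' i = freeze (decrease_counters K s) i;
  outcome_freeze_ge : forall i j g, i \in unfrozen K s -> mu i = None ->
    mu j = Some g -> g \in high_of K i ->
    pool s' = set0 \/ (freeze_duration K i <= freeze s' j)%E;
  outcome_freeze_le : forall j, freeze s' j = freeze (decrease_counters K s) j \/
    exists i g, [/\ i \in unfrozen K s, mu i = None, mu j = Some g,
      g \in high_of K i & freeze s' j = freeze_duration K i]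
}.

Lemma phase_has_outcome rr_order s s' :
    perm_eq rr_order (enum 'I_n) -> phase K pref rr_order s s' ->
  exists mu gift, phase_outcome mu gift s s'.
Proof.
move=> perm_rr [s1 [[mu [order [prio perm_order serve]]] rr]].
have [[[mu_in mu_inj] _] _] := prio.
have mem_order i : (i \in order) = (i \in unfrozen K s) && (mu i == None).
  by rewrite (perm_mem perm_order) mem_enum !inE andbC; case: (mu i).
have uniq_order : uniq order by rewrite (perm_uniq perm_order) enum_uniq.
have mem_rr i : (i \in [seq i <- rr_order | ~~ in_M K i]) = ~~ in_M K i.
  by rewrite mem_filter (perm_mem perm_rr) mem_enum andbT.
have uniq_rr : uniq [seq i <- rr_order | ~~ in_M K i].
  by rewrite filter_uniq // (perm_uniq perm_rr) enum_uniq.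
have ho0 : handout mu s (give_matched mu (decrease_counters K s)).
  by split=> // i g /mu_in [].
have [|gift1 [ho1 g1 e1]] := serve_unmatched_handout serve uniq_order ho0.
  by move=> i; rewrite mem_order => /andP[_ /eqP].
have muM i : ~~ in_M K i -> mu i = None.
  by case mi: (mu i) => [g|//]; have [] := mu_in _ _ mi; rewrite inE => /andP[->].
have gift1R i : ~~ in_M K i -> gift1 i = None.
  by move=> iR; rewrite g1 ?muM // mem_order inE (negPf iR).
have [|gift [ho h1 h2 h3]] := round_robin_handout rr uniq_rr ho1.
  by move=> i; rewrite mem_rr; apply: gift1R.
have giftM i : in_M K i -> gift i = gift1 i.
  by move=> iM; rewrite h1 // mem_rr iM.
have [f1 f2 f3 f4] := serve_unmatched_freeze serve.
have pool01 : pool s1 = set0 -> pool s' = set0.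
  by move=> s1e; apply/eqP; rewrite -subset0 -s1e (round_robin_pool_sub rr).
exists mu, gift; split=> //.
- move=> i g mi; have [iU _ _] := mu_in _ _ mi.
  rewrite giftM; last by move: iU; rewrite inE => /andP[].
  by rewrite g1 // mem_order mi andbF.
- move=> i iM fi; have iU : i \notin unfrozen K s by rewrite inE fi andbF.
  rewrite giftM // g1 ?mem_order ?(negPf iU) //.
  by case mi: (mu i) => [g|//]; have [] := mu_in _ _ mi; rewrite (negPf iU).
- move=> i; case iM: (in_M K i) => /=; last first.
    by move=> gi; left; apply: h2 gi; rewrite mem_rr iM.
  rewrite giftM //; case: ltP => fi gi; first by right.
  have iU : i \in unfrozen K s by rewrite inE iM -leNgt.
  left; apply: pool01; apply: e1 (gi); rewrite mem_order iU.
  case mi: (mu i) => [g|//]; have := g1 i; rewrite mem_order mi andbF gi.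
  by move=> /(_ isT).
- by move=> i g p iR; apply: h3; rewrite mem_rr.
- by move=> i mi; rewrite (round_robin_freeze rr) f2.
- move=> i j g iU mi mj gi; rewrite (round_robin_freeze rr).
  by have [|/pool01|] := f3 i j g _ mj gi; [rewrite mem_order iU mi|left|right].
- move=> j; rewrite (round_robin_freeze rr).
  case: (f4 j) => [->|[i [g [io mj gi e]]]]; [by left | right].
  by exists i, g; move: io; rewrite mem_order => /andP[iU /eqP].
Qed.

End Phase.

(** * Prioritized matchings *)

(** Climbing from [x] ends: [A] contains all candidates above the current element and loses one at
    each climb. *)
Lemma exists_maximal (T : finType) (P : T -> Prop) (lt : T -> T -> Prop) x :
    (forall y, ~ lt y y) -> (forall y1 y2 y3, lt y1 y2 -> lt y2 y3 -> lt y1 y3) ->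
  P x -> exists2 y, P y & forall z, P z -> ~ lt y z.
Proof.
move=> irr tr; have [k] := ubnP #|[set: T]|.
have : forall y, P y -> lt x y -> y \in [set: T] by [].
elim: k [set: T] x => [//|k IH] A x up le_k Px.
have [[y [Py xy]]|none] := boolp.EM (exists y, P y /\ lt x y).
  apply: (IH (A :\ y) y) => // [z Pz yz|].
    rewrite !inE up ?andbT //; last exact: tr yz.
    by apply/eqP => e; rewrite e in yz; apply: (irr y).
  by move: le_k; rewrite (cardsD1 y) up.
by exists x => // y Py xy; apply: none; exists y.
Qed.

Section Matchings.
Variables (R : realType) (n : nat) (G : finType).
Variable K : 'I_n -> option (knowledge R G).
Implicit Types (U : {set 'I_n}) (P : {set G}) (mu : {ffun 'I_n -> option G}).

Lemma higher_priority_trans mu1 mu2 mu3 :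
  higher_priority K mu2 mu1 -> higher_priority K mu3 mu2 -> higher_priority K mu3 mu1.
Proof.
move=> [r [lt12 eq12]] [r' [lt23 eq23]].
(* The decisive ratio of the composite is the larger of [r] and [r']: above it all three matchings
   agree. *)
have [rr'|r'r|er] := ltgtP r r'.
- exists r'; split=> [|r'' lt]; first by rewrite eq12.
  by rewrite eq12 ?(lt_trans rr' lt) ?eq23.
- exists r; split=> [|r'' lt]; first by rewrite -eq23.
  by rewrite eq12 ?eq23 ?(lt_trans r'r lt).
- exists r; split=> [|r'' lt]; first by rewrite (ltn_trans lt12) // er.
  by rewrite eq12 ?eq23 // -er.
Qed.

(** Maximize the cardinality first, starting from the empty matching, then the priority among
    maximum matchings. *)
Lemma prioritized_matching_exists U P : exists mu, prioritized_matching K U P mu.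
Proof.
have [|||mu1 match1 max1] := @exists_maximal _ (is_matching K U P)
  (fun mu mu' => #|matched mu| < #|matched mu'|)%N [ffun=> None].
- by move=> mu; rewrite ltnn.
- by move=> mu1 mu2 mu3; apply: ltn_trans.
- by split=> [i g|i j g]; rewrite ffunE.
have mu1_max : maximum_matching K U P mu1.
  by split=> // mu /max1 /negP; rewrite -leqNgt.
have [||mu] := @exists_maximal _ (maximum_matching K U P)
  (fun mu mu' => higher_priority K mu' mu) mu1 _ _ mu1_max; last by exists mu.
- by move=> mu [r []]; rewrite ltnn.
- by move=> mu mu' mu'' h1 h2; apply: higher_priority_trans h1 h2.
Qed.

(** Otherwise matching [i] to [p] would enlarge [mu]. *)
Lemma unmatched_high_taken U P mu i p :
    maximum_matching K U P mu -> i \in U -> mu i = None ->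
    p \in P -> p \in high_of K i ->
  exists j, mu j = Some p.
Proof.
move=> [[mu_in mu_inj] mu_max] iU mi pP pH.
case: (boolP [exists j, mu j == Some p]) => [/existsP[j /eqP]|]; first by exists j.
rewrite negb_exists => /forallP pN.
set mu' := [ffun j => if j == i then Some p else mu j].
have /mu_max : is_matching K U P mu'.
  split=> [j g|j k g]; rewrite !ffunE.
    by case: eqVneq => [-> [<-]|_ /mu_in].
  case: eqVneq => [->|ji]; case: eqVneq => [->|ki] //; last exact: mu_inj.
    by move=> [<-] mk; have := pN k; rewrite mk eqxx.
  by move=> mj [eg]; have := pN j; rewrite mj eg eqxx.
have -> : matched mu' = i |: matched mu.
  by apply/setP => j; rewrite !inE ffunE; case: eqVneq.
by rewrite cardsU1 inE mi /= add1n ltnn.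
Qed.

Section Exchange.
Variables (U : {set 'I_n}) (P : {set G}) (mu : {ffun 'I_n -> option G}).
Variables (i j : 'I_n) (g : G).
Hypotheses (mu_max : maximum_matching K U P mu) (iU : i \in U).
Hypotheses (mi : mu i = None) (mj : mu j = Some g) (gi : g \in high_of K i).

(** [i] takes over the good of [j]; the size is unchanged, so the matching is again maximum. *)
Let mu' := [ffun k => if k == i then Some g else if k == j then None else mu k].

Let ij : i != j.
Proof. by apply/eqP => e; move: mj; rewrite -e mi. Qed.

Let matched_exchange : matched mu' = i |: (matched mu :\ j).
Proof.
by apply/setP => k; rewrite !inE ffunE; case: eqVneq => // _; case: eqVneq.
Qed.

Let exchange_max : maximum_matching K U P mu'.
Proof.
have [[mu_in mu_inj] mu_card] := mu_max.
split.
  split=> [k p|k k' p]; rewrite !ffunE.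
    case: eqVneq => [-> [<-]|_]; first by have [_ gP _] := mu_in _ _ mj.
    by case: eqVneq => // _ /mu_in.
  case: eqVneq => [->|ki].
    case: eqVneq => [->//|_] [<-]; case: eqVneq => // k'j mk'.
    by move: k'j; rewrite (mu_inj _ _ _ mk' mj) eqxx.
  case: eqVneq => // kj mk.
  case: eqVneq => [_ [eg]|_].
    by move: kj; rewrite -eg in mk; rewrite (mu_inj _ _ _ mk mj) eqxx.
  by case: eqVneq => // _; apply: mu_inj.
move=> nu /mu_card; rewrite matched_exchange cardsU1 !inE mi andbF.
by rewrite (cardsD1 j (matched mu)) inE mj.
Qed.

(** After the exchange [j] is an unmatched agent, so her high goods are all taken; the good now held
    by [i] is held by [j] in [mu]. *)
Lemma exchange_high_taken p : p \in P -> p \in high_of K j -> exists k, mu k = Some p.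
Proof.
have [[mu_in _] _] := mu_max.
move=> pP pj; have [jU _ _] := mu_in _ _ mj.
have [|k] := unmatched_high_taken exchange_max jU _ pP pj.
  by rewrite ffunE eq_sym (negPf ij) eqxx.
rewrite ffunE; case: eqVneq => [_ [<-]|_]; first by exists j.
by case: eqVneq => // _; exists k.
Qed.

(** If [i] had the larger ratio, the exchange would add one matched agent at that ratio and change
    nothing above it, against the priority of [mu]. *)
Lemma exchange_ratio_le :
    (forall nu, maximum_matching K U P nu -> ~ higher_priority K nu mu) ->
  (value_ratio K i <= value_ratio K j)%E.
Proof.
move=> prio; rewrite leNgt; apply/negP => lt_ratio.
apply: (prio _ exchange_max); exists (value_ratio K i).
rewrite /matched_at_ratio matched_exchange; split.
  rewrite (_ : [set k in i |: _ | _] =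
    i |: [set k in matched mu | value_ratio K k == value_ratio K i]).
    by rewrite cardsU1 !inE mi.
  apply/setP => k; rewrite !inE; case: (eqVneq k i) => [->|ki] /=; first by rewrite eqxx.
  by case: (eqVneq k j) => [->|//]; rewrite (lt_eqF lt_ratio) !andbF.
move=> r lt_r; apply: eq_card => k; rewrite !inE.
case: (eqVneq k i) => [->|ki] /=; first by rewrite (lt_eqF lt_r) andbF.
by case: (eqVneq k j) => [->|//]; rewrite (lt_eqF (lt_trans lt_ratio lt_r)) !andbF.
Qed.

End Exchange.

Lemma serve_unmatched_exists mu agents s : exists s', serve_unmatched K mu agents s s'.
Proof.
elim: agents s => [|i agents IH] s; first by exists s; constructor.
have [s0e|[g gs]] := set_0Vmem (pool s).
  by have [s' ss'] := IH s; exists s'; apply: serve_empty.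
by have [s' ss'] := IH (freeze_for K mu i (give i g s)); exists s'; apply: serve_give ss'.
Qed.

Variable pref : 'I_n -> rel G.
Hypothesis pref_linear : forall i, strict_linear_order (pref i).

Lemma round_robin_exists agents s : exists s', round_robin pref agents s s'.
Proof.
elim: agents s => [|i agents IH] s; first by exists s; constructor.
have [s0e|[p ps]] := set_0Vmem (pool s).
  by have [s' ss'] := IH s; exists s'; apply: rr_empty.
have [irr tr tot] := pref_linear i.
have [||g gs gmax] := @exists_maximal _ (fun g => g \in pool s)
  (fun g g' => pref i g' g) p _ _ ps.
- by move=> g; rewrite irr.
- by move=> g1 g2 g3 h1 h2; apply: tr h2 h1.
have [s' ss'] := IH (give i g s); exists s'; apply: rr_give ss'.
split=> // g' g's g'g; have /orP[|//] := tot _ _ g'g.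
by move=> h; case: (gmax g').
Qed.

Lemma phase_exists rr_order s : exists s', phase K pref rr_order s s'.
Proof.
have [mu prio] := prioritized_matching_exists (unfrozen K s) (pool s).
have [s1 serve] := serve_unmatched_exists mu (enum (unfrozen K s :\: matched mu))
  (give_matched mu (decrease_counters K s)).
have [s' rr] := round_robin_exists [seq i <- rr_order | ~~ in_M K i] s1.
exists s', s1; split=> //; exists mu; eexists; split; [exact: prio| |exact: serve].
exact: perm_refl.
Qed.

End Matchings.

(** * Invariants *)

Lemma subr1_ge0e (x : \bar int) : (0 < x -> 0 <= x - 1)%E.
Proof. by case: x => //= z; rewrite lte_fin -EFinB lee_fin; lia. Qed.

Lemma natrS_mul (R : pzRingType) (m : nat) (x : R) : m.+1%:R * x = m%:R * x + x.
Proof. by rewrite -natr1 mulrDl mul1r. Qed.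

(** * Bounds on freeze durations *)

Section FreezeDuration.
Variables (R : realType) (n : nat) (G : finType).
Variable K : 'I_n -> option (knowledge R G).
Implicit Types i : 'I_n.

Lemma freeze_duration_le i j : (value_ratio K i <= value_ratio K j)%E ->
  (freeze_duration K i <= freeze_duration K j)%E.
Proof.
move=> h; have : (value_ratio K i - 1 <= value_ratio K j - 1)%E by rewrite leeD2r.
rewrite /freeze_duration; move: (value_ratio K i - 1)%E (value_ratio K j - 1)%E.
move=> [x||] [y||] //=; rewrite ?leey ?leNye // !lee_fin.
exact: le_floor.
Qed.

Variables (i : 'I_n) (k : knowledge R G).
Hypotheses (Ki : K i = Some k) (low_ge0 : 0 <= low k) (low_lt : low k < high k).

Lemma freeze_duration_fin : low k != 0 ->
  freeze_duration K i = (Num.floor (high k / low k - 1))%:E.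
Proof.
by rewrite /freeze_duration /value_ratio Ki inver => /negPf ->.
Qed.

Lemma freeze_duration_infty : low k = 0 -> freeze_duration K i = +oo%E.
Proof.
rewrite /freeze_duration /value_ratio Ki inver => l0; rewrite l0 eqxx.
by rewrite gt0_muley // lte_fin -l0.
Qed.

Lemma freeze_duration_ge0 : (0 <= freeze_duration K i)%E.
Proof.
have [/freeze_duration_infty ->|l0] := eqVneq (low k) 0; first exact: leey.
have lp : 0 < low k by rewrite lt_def l0.
by rewrite freeze_duration_fin // lee_fin floor_ge0 subr_ge0 ler_pdivlMr // mul1r ltW.
Qed.

(** A zero [low k] makes the duration infinite and the premise false. Otherwise the floor is at most
    [r], so [high k / low k - 1 < r + 1]. *)
Lemma high_le_freeze_duration r :
  (freeze_duration K i <= r%:Z%:E)%E -> high k <= (r%:R + 2) * low k.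
Proof.
have [/freeze_duration_infty ->//|l0] := eqVneq (low k) 0.
have lp : 0 < low k by rewrite lt_def l0.
rewrite freeze_duration_fin // lee_fin => le_r.
rewrite -ler_pdivrMr //.
have /andP[_] := floor_itv (high k / low k - 1); rewrite intrD.
have : (Num.floor (high k / low k - 1))%:~R <= r%:R :> R by rewrite -(ler_int R) in le_r.
lra.
Qed.

(** [fine] sends [+oo] to 0, which is harmless: an infinite counter forces [low k = 0], and then the
    bound is just [0 <= high k]. *)
Lemma freeze_duration_upper (f : \bar int) : (0 <= f)%E ->
    (f <= freeze_duration K i)%E ->
  (f = +oo%E -> low k = 0) /\ (fine f)%:~R * low k <= high k - low k.
Proof.
have [-> _ _|l0] := eqVneq (low k) 0.
  by rewrite mulr0 subr0; split=> //; apply/ltW/(le_lt_trans low_ge0).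
have lp : 0 < low k by rewrite lt_def l0.
rewrite freeze_duration_fin //; case: f => //= z _; rewrite lee_fin => le_z.
split=> //; have : z%:~R <= (Num.floor (high k / low k - 1))%:~R :> R by rewrite ler_int.
move=> /le_trans /(_ (floor_le _)); rewrite lerBrDr ler_pdivlMr //.
by rewrite mulrDl mul1r lerBrDr.
Qed.

End FreezeDuration.

Section Invariant.
Variables (R : realType) (n : nat) (G : finType).
Variable v : 'I_n -> G -> R.
Variable K : 'I_n -> option (knowledge R G).
Variable pref : 'I_n -> rel G.
Hypothesis K_learned : forall i, learned n (v i) (K i).
Hypothesis pref_consistent : consistent_rankings v pref.
Hypothesis n_gt0 : (0 < n)%N.
Hypothesis v_ge0 : forall i g, 0 <= v i g.
Implicit Types (i j : 'I_n) (s : state n G) (gift : 'I_n -> option G).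
Implicit Types (mu : {ffun 'I_n -> option G}) (k : knowledge R G).

Local Notation value i s j := (bundle_value v i (bundles s j)).

Definition well_allocated s : Prop :=
  (forall g i, g \in bundles s i ->
     g \notin pool s /\ forall j, g \in bundles s j -> j = i) /\
  (forall g, g \in pool s \/ exists i, g \in bundles s i).

Lemma well_allocated_handout gift s s' :
  well_allocated s -> handout gift s s' -> well_allocated s'.
Proof.
move=> [alloc cover] ho; have [hb hp hg hi] := ho.
have mem_bundle g i : g \in bundles s' i -> g \in bundles s i \/ gift i = Some g.
  by rewrite hb; case: (gift i) => [p|]; [rewrite !inE => /orP[/eqP ->|]|]; auto.
split.
  move=> g i /mem_bundle [gi|gi].
    have [gN guniq] := alloc g i gi.
    split=> [|j /mem_bundle [/guniq//|/hg]]; last by rewrite (negPf gN).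
    by apply: contra gN; apply: (subsetP (handout_pool_sub ho)).
  split=> [|j /mem_bundle [/alloc [] | ]]; first exact: handout_gift_notin ho gi.
    by rewrite (hg _ _ gi).
  by move=> gj; apply: hi gj gi.
move=> g; case: (cover g) => [/(handout_mem_pool ho) [|[i gi]]|[i gi]]; first by left.
  by right; exists i; rewrite hb gi !inE eqxx.
by right; exists i; rewrite hb; case: (gift i) => // p; rewrite !inE gi orbT.
Qed.

Lemma bundle_value_ge0 i X : 0 <= bundle_value v i X.
Proof. exact: sumr_ge0. Qed.

Lemma bundle_value_handout gift s s' i j :
    well_allocated s -> handout gift s s' ->
  value i s' j = value i s j + oapp (v i) 0 (gift j).
Proof.
move=> [alloc _] [-> _ hg _]; case gj: (gift j) => [g|] /=; last by rewrite addr0.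
rewrite /bundle_value big_setU1 /=; first by rewrite addrC.
by apply/negP => /alloc [/negP]; case; apply: hg gj.
Qed.

Lemma card_bundle_handout gift s s' j : handout gift s s' ->
  (#|bundles s' j| <= #|bundles s j| + isSome (gift j))%N.
Proof.
move=> [-> _ _ _]; case: (gift j) => [g|] /=; last by rewrite addn0.
by rewrite cardsU1 addnC leq_add2l leq_b1.
Qed.

Lemma bundle_valueD1 i (X : {set G}) g : g \in X ->
  bundle_value v i (X :\ g) = bundle_value v i X - v i g.
Proof. by move=> gX; rewrite /bundle_value (big_setD1 g gX) /= addrAC subrr add0r. Qed.

(** The clause on the pool makes this inductive: a good given to [j] is
    compensated for by the good that [i] got in the previous phase. *)
Definition round_robin_invariant i s : Prop :=
  exists2 top, (forall g, v i g <= v i top) &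
    [/\ forall j, value i s j <= v i top + value i s i,
        forall j g, g \in pool s -> value i s j + v i g <= v i top + value i s i &
        v i top <= value i s i \/ pool s = [set: G]].

Lemma round_robin_invariant_init i :
  K i = None -> round_robin_invariant i initial_state.
Proof.
move=> Ki; have := K_learned i; rewrite Ki => -[A [cardA topA]].
have [g gA] : exists g, g \in A by apply/set0Pn; rewrite -card_gt0 cardA.
exists g => [g'|]; first exact: topA.
rewrite /bundle_value /=; split=> [j|j g' _|]; rewrite ?big_set0 ?addr0 ?add0r //.
- exact: topA.
- by right.
Qed.

(** The others receive at most [n - 1] goods, so some [p] among the [n] best goes to none of them;
    [i] then gets [p] or a good she ranks above it. *)
Lemma first_gift mu gift s s' i top :
    phase_outcome K pref mu gift s s' -> K i = None -> pool s = [set: G] ->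
    (forall g, v i g <= v i top) ->
  exists2 g, gift i = Some g & v i g = v i top.
Proof.
move=> out Ki pT le_top.
have := K_learned i; rewrite Ki => -[A [cardA topA]].
have ho := outcome_handout out.
(* Agents without a gift contribute the default [top]; [B] still has at most [n - 1] elements. *)
set B := [set odflt top (gift j) | j in [set~ i]].
have [p pA pB] : exists2 p, p \in A & p \notin B.
  apply/subsetPn/negP => /subset_leq_card; rewrite cardA leqNgt => /negP; apply.
  apply: leq_ltn_trans (leq_imset_card _ _) _.
  by rewrite cardsC1 card_ord prednK.
have pN j : gift j = Some p -> j = i.
  move=> jp; apply/eqP; apply: contraNT pB => ji.
  by apply/imsetP; exists j; rewrite ?inE // jp.
have vp : v i p = v i top by apply/eqP; rewrite eq_le le_top topA.
have ps : p \in pool s by rewrite pT inE.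
case gi: (gift i) => [g|]; last first.
  case: (outcome_served out gi) => [pe|]; last by rewrite /in_M Ki.
  case: (handout_mem_pool ho ps) => [|[j /[dup] /pN -> ]]; first by rewrite pe inE.
  by rewrite gi.
exists g => //; have [<-//|pg] := eqVneq p g.
have iR : ~~ in_M K i by rewrite /in_M Ki.
have [/pref_consistent vg|[j ji /pN e]] := outcome_round_robin out iR gi ps pg.
  by apply/eqP; rewrite eq_le le_top -vp.
by rewrite e eqxx in ji.
Qed.

Lemma round_robin_invariant_step mu gift s s' i :
    phase_outcome K pref mu gift s s' -> well_allocated s -> K i = None ->
  round_robin_invariant i s -> round_robin_invariant i s'.
Proof.
move=> out alloc Ki [top le_top [h1 h2 h3]]; have ho := outcome_handout out.
have iR : ~~ in_M K i by rewrite /in_M Ki.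
have val j := bundle_value_handout i j alloc ho.
have gain j : 0 <= oapp (v i) 0 (gift j) by case: (gift j) => /=.
exists top => //; split.
- move=> j; rewrite !val; case gj: (gift j) => [g|] /=.
    have [_ _ hg _] := ho; have := h2 j g (hg _ _ gj); have := gain i; lra.
  by have := h1 j; have := gain i; lra.
- move=> j p ps'; rewrite !val.
  case gi: (gift i) => [g|]; last first.
    case: (outcome_served out gi) => [pe|]; last by rewrite /in_M Ki.
    by rewrite pe inE in ps'.
  have ps : p \in pool s := subsetP (handout_pool_sub ho) _ ps'.
  have pN j' : gift j' <> Some p.
    by move=> /(handout_gift_notin ho); rewrite ps'.
  have pg : p != g by apply/eqP => e; case: (pN i); rewrite e.
  (* As [p] survives the phase, [i] took a good at least as valuable; this pays for [p], and the old
     clause on the pool pays for the gift of [j]. *)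
  have vpg : v i p <= v i g.
    by have [/pref_consistent //|[j' _ /pN]] := outcome_round_robin out iR gi ps pg.
  case gj: (gift j) => [g'|] /=.
    have [_ _ hg _] := ho; have := h2 j g' (hg _ _ gj); lra.
  by have := h1 j; lra.
- left; rewrite val; case: h3 => [le_i|pT]; first by have := gain i; lra.
  have [g -> /= ->] := first_gift out Ki pT le_top.
  by have := bundle_value_ge0 i (bundles s i); lra.
Qed.

(** * Agents of M *)

Section Matcher.
Variables (i : 'I_n) (k : knowledge R G).
Hypothesis Ki : K i = Some k.
Local Notation h := (high k).
Local Notation l := (low k).
Local Notation H := (high_goods k).
Local Notation empty s := ((pool s == set0)%:R : R).

Let high_low : [/\ 0 <= l, l < h &
  forall g, v i g = if g \in high_goods k then h else l].
Proof. by have := K_learned i; rewrite Ki. Qed.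

Let high_ofi : high_of K i = H.
Proof. by rewrite /high_of Ki. Qed.

(** Here [i] was matched in [u] phases, and then unmatched in [r + 1] phases.
    The last two cases are those of an agent [j] who got a high good in the first
    phase where [i] was unmatched. *)
Variant rival_invariant u r s j : Prop :=
| RivalLow of value i s j <= u%:R * h + (r.+1)%:R * l
| RivalFrozen of in_M K j & (#|bundles s j| <= u.+1)%N &
    pool s = set0 \/ (freeze_duration K i <= freeze s j + r%:Z%:E)%E
| RivalThawed of (0 < r)%N & value i s j <= u%:R * h + (r.+2)%:R * l.

(** The terms [empty s * l] account for the last phase, in which [i] may get
    nothing. *)
Variant match_invariant s : Prop :=
| AlwaysMatched u of freeze s i = 0%E & u%:R * h <= value i s i &
    forall j, (#|bundles s j| <= u)%N
| OnceUnmatched u r of freeze s i = 0%E & [disjoint pool s & H] &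
    u%:R * h + (r.+1)%:R * l <= value i s i + empty s * l &
    forall j, rival_invariant u r s j
| OnceFrozen of (0 <= freeze s i)%E & [disjoint pool s & H] &
    h <= value i s i & (freeze s i = +oo%E -> l = 0) &
    forall j, value i s j + (fine (freeze s i))%:~R * l
      <= value i s i + h - l + empty s * l.

Lemma match_invariant_init : match_invariant initial_state.
Proof.
apply: (@AlwaysMatched _ 0) => [//||j]; rewrite ?mul0r ?bundle_value_ge0 //.
by rewrite /= cards0.
Qed.

Lemma value_le_card j s : value i s j <= #|bundles s j|%:R * h.
Proof.
rewrite /bundle_value mulr_natl -sumr_const; apply: ler_sum => g _.
by have [_ lh ->] := high_low; case: ifP => // _; apply: ltW.
Qed.

Lemma low_le g : l <= v i g.
Proof. by have [_ lh ->] := high_low; case: ifP => // _; apply: ltW. Qed.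

Variables (mu : {ffun 'I_n -> option G}) (gift : 'I_n -> option G).
Variables (s s' : state n G).
Hypothesis out : phase_outcome K pref mu gift s s'.
Hypothesis alloc : well_allocated s.
Hypothesis pool_n0 : pool s != set0.

Let ho := outcome_handout out.
Let val j := bundle_value_handout i j alloc ho.
Let hl0 : 0 <= l. Proof. by case: high_low. Qed.
Let hlh : l < h. Proof. by case: high_low. Qed.
Let h_ge0 : 0 <= h. Proof. exact/ltW/(le_lt_trans hl0). Qed.
Let gift_pool j g : gift j = Some g -> g \in pool s.
Proof. by case: ho => _ _ + _; apply. Qed.

Let empty_s : empty s = 0.
Proof. by rewrite (negPf pool_n0). Qed.

Let empty_s' : 0 <= empty s'.
Proof. by rewrite ler0n. Qed.

Let iM : in_M K i.
Proof. by rewrite /in_M Ki. Qed.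

Let disjoint_step : [disjoint pool s & H] -> [disjoint pool s' & H].
Proof. exact/disjointWl/(handout_pool_sub ho). Qed.

Let disjoint_low j g : [disjoint pool s & H] -> gift j = Some g -> v i g = l.
Proof.
move=> dis /gift_pool gs; have [_ _ ->] := high_low.
by rewrite (disjointFr dis gs).
Qed.

Let disjoint_unmatched : [disjoint pool s & H] -> mu i = None.
Proof.
move=> dis; case mi: (mu i) => [g|//].
have [[[mu_in _] _] _] := outcome_matching out.
by have [_ gs] := mu_in _ _ mi; rewrite high_ofi (disjointFr dis gs).
Qed.

Let unfrozen_freeze : freeze s i = 0%E -> mu i = None -> freeze s' i = 0%E.
Proof. by move=> f0 mi; rewrite (outcome_freeze_unmatched out mi) /= f0 ltxx andbF. Qed.

Let unfrozen_gain : freeze s i = 0%E -> gift i = None -> pool s' = set0.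
Proof. by move=> f0 /(outcome_served out); rewrite f0 ltxx andbF => -[]. Qed.

Let low_gain j : [disjoint pool s & H] -> oapp (v i) 0 (gift j) <= l.
Proof.
by move=> dis; case gj: (gift j) => [g|] //=; rewrite (disjoint_low dis gj).
Qed.

Let low_gain_self : [disjoint pool s & H] -> freeze s i = 0%E ->
  l <= oapp (v i) 0 (gift i) + empty s' * l.
Proof.
move=> dis f0; case gi: (gift i) => [g|] /=.
  by rewrite (disjoint_low dis gi) lerDl mulr_ge0.
by rewrite (unfrozen_gain f0 gi) eqxx add0r mul1r.
Qed.

Lemma rival_invariant_step u r j : [disjoint pool s & H] ->
  rival_invariant u r s j -> rival_invariant u r.+1 s' j.
Proof.
move=> dis [lej|jM cardj frozen|r0 lej].
- apply: RivalLow; rewrite val; have := low_gain j dis.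
  by move: lej; rewrite (natrS_mul r.+1); lra.
- have {frozen} frozen : (freeze_duration K i <= freeze s j + r%:Z%:E)%E.
    by case: frozen => // e; have := pool_n0; rewrite e eqxx.
  have card' := card_bundle_handout j ho.
  have [fj|fj] := ltP 0%E (freeze s j).
    have gj := outcome_frozen out jM fj.
    apply: RivalFrozen => //; first by rewrite gj addn0 in card'; apply: leq_trans cardj.
    (* The counter loses 1 while [r] gains 1, so their sum is unchanged. *)
    right; have -> : freeze s' j = (freeze s j - 1)%E.
      rewrite (outcome_freeze_unmatched out) /= ?jM ?fj //.
      by case mj: (mu j) => [g|//]; have := outcome_matched out mj; rewrite gj.
    apply: le_trans frozen _; case: (freeze s j) => [z||] //=.
    by rewrite -EFinB -!EFinD lee_fin intS addrA subrK.
  (* [j] is no longer frozen, so the duration is at most [r]. Trading one of the [u.+1] goods of [j]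
     for [r + 2] low ones and adding the low good of this phase gives the [r.+3] low goods of
     [RivalThawed] at [r.+1]. *)
  have le_h : h <= (r%:R + 2) * l.
    apply: (high_le_freeze_duration Ki hl0 hlh); apply: le_trans frozen _.
    by rewrite -[leRHS]add0e leeD2r.
  case gj: (gift j) => [g|] in card' *; last first.
    apply: RivalFrozen => //; first by rewrite addn0 in card'; apply: leq_trans cardj.
    left; case: (outcome_served out gj) => // /andP[_].
    by rewrite ltNge fj.
  apply: RivalThawed => //; rewrite val gj /= (disjoint_low dis gj).
  have : value i s j <= u.+1%:R * h.
    by apply: le_trans (value_le_card j s) _; rewrite ler_wpM2r ?ler_nat //.
  by rewrite !(natrS_mul u, natrS_mul r.+2, natrS_mul r.+1, natrS_mul r); lra.
- apply: RivalThawed => //; rewrite val; have := low_gain j dis.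
  by move: lej; rewrite (natrS_mul r.+2); lra.
Qed.

(** As [i] is unmatched, the maximum matching takes every available good that is high for her, and
    nobody receives such a good outside it. *)
Lemma gifted_high_matched : freeze s i = 0%E -> mu i = None ->
  forall j g, gift j = Some g -> g \in H -> mu j = Some g.
Proof.
move=> f0 mi j g gj gH; have [mu_max _] := outcome_matching out.
have iU : i \in unfrozen K s by rewrite inE iM f0 ltxx.
have [|j' mj'] := unmatched_high_taken mu_max iU mi (gift_pool gj) _.
  by rewrite high_ofi.
have [_ _ _ inj] := ho.
by rewrite (inj _ _ _ gj (outcome_matched out mj')).
Qed.

Lemma match_invariant_step : match_invariant s -> match_invariant s'.
Proof.
have mu_match := outcome_matching out; have [mu_max prio] := mu_match.
have [[mu_in mu_inj] _] := mu_max.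
case=> [u f0 lei cardj|u r f0 dis lei rival|f0 dis le_h foo lej].
- have iU : i \in unfrozen K s by rewrite inE iM f0 ltxx.
  have card' j : (#|bundles s' j| <= u.+1)%N.
    rewrite -addn1; apply: leq_trans (card_bundle_handout j ho) _.
    exact: leq_add (cardj j) (leq_b1 _).
  case mi: (mu i) => [g|].
    have [_ _ gH] := mu_in _ _ mi; rewrite high_ofi in gH.
    have val' : u.+1%:R * h <= value i s' i.
      rewrite val (outcome_matched out mi) /=; have [_ _ ->] := high_low; rewrite gH.
      by rewrite natrS_mul lerD2r.
    (* [i] was matched. Either her counter is still 0, or an unmatched [i'] freezes her, which leads
       to [OnceFrozen]. *)
    case: (outcome_freeze_le out i) => [f'|[i' [g' [i'U mi' mi2 g'H f']]]].
      by apply: (@AlwaysMatched _ u.+1) => //; rewrite f' /= f0 ltxx andbF.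
    have [k' Ki'] : exists k', K i' = Some k'.
      by move: i'U; rewrite inE /in_M; case: (K i') => // k' _; exists k'.
    (* By priority the ratio of [i'] is at most that of [i], so the counter times [l] is at most
       [h - l], the slack in [OnceFrozen]. *)
    have le_dur : (freeze_duration K i' <= freeze_duration K i)%E.
      apply: freeze_duration_le; exact: exchange_ratio_le mu_max i'U mi' mi2 g'H prio.
    have dur0 : (0 <= freeze_duration K i')%E.
      have := K_learned i'; rewrite Ki' => -[l0' lh' _].
      exact: freeze_duration_ge0 Ki' l0' lh'.
    have [inf fin] := freeze_duration_upper Ki hl0 hlh dur0 le_dur.
    have le_h : h <= value i s' i.
      apply: le_trans val'; rewrite natrS_mul lerDr.
      by rewrite mulr_ge0.
    apply: OnceFrozen => //; rewrite ?f' //.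
      apply/pred0P => p /=; apply/negbTE/negP => /andP[ps' pH].
      have ps := subsetP (handout_pool_sub ho) _ ps'.
      have [|j mj] := exchange_high_taken mu_max i'U mi' mi2 g'H ps _.
        by rewrite high_ofi.
      by have := handout_gift_notin ho (outcome_matched out mj); rewrite ps'.
    move=> j; have : value i s' j <= u.+1%:R * h.
      by apply: le_trans (value_le_card j s') _; rewrite ler_wpM2r ?ler_nat //.
    have : 0 <= empty s' * l by rewrite mulr_ge0.
    by lra.
  (* [i] is unmatched for the first time, so [r = 0]. A rival either gains at most [l], or was
     matched to a good high for [i] and is frozen, unless the pool is now empty. *)
  have taken := gifted_high_matched f0 mi.
  have mu_none_low j : (if mu j is Some g then g \notin H else true) ->
      oapp (v i) 0 (gift j) <= l.
    case gj: (gift j) => [g|] //=; have [_ _ ->] := high_low.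
    by case: ifP => [gH|//]; rewrite (taken _ _ gj gH) gH.
  apply: (@OnceUnmatched _ u 0); first exact: unfrozen_freeze.
  + apply/pred0P => p /=; apply/negbTE/negP => /andP[ps' pH].
    have ps := subsetP (handout_pool_sub ho) _ ps'.
    have [|j mj] := unmatched_high_taken mu_max iU mi ps _.
      by rewrite high_ofi.
    by have := handout_gift_notin ho (outcome_matched out mj); rewrite ps'.
  + rewrite mul1r val -addrA; apply: lerD => //.
    case gi: (gift i) => [p|] /=; last by rewrite (unfrozen_gain f0 gi) eqxx add0r mul1r.
    by apply: le_trans (low_le p) _; rewrite lerDl mulr_ge0.
  + move=> j; case: (boolP (if mu j is Some g then g \notin H else true)) => [lowj|].
      apply: RivalLow; rewrite val mul1r.
      apply: lerD; last exact: mu_none_low.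
      apply: le_trans (value_le_card j s) _; rewrite ler_wpM2r ?ler_nat //.
    case mj: (mu j) => [g|//]; rewrite negbK => gH.
    apply: RivalFrozen => //.
      by have [] := mu_in _ _ mj; rewrite inE => /andP[].
    have := outcome_freeze_ge out iU mi mj; rewrite high_ofi => /(_ gH).
    by rewrite adde0.
- apply: (@OnceUnmatched _ u r.+1); [|exact: disjoint_step| |].
  + by apply: unfrozen_freeze => //; apply: disjoint_unmatched.
  + move: lei; rewrite empty_s mul0r addr0 val.
    have := low_gain_self dis f0.
    by rewrite (natrS_mul r.+1); lra.
  + by move=> j; apply: rival_invariant_step.
(* After a freeze nobody gains more than [l] per phase. While [i] is frozen, the unit taken off her
   counter pays for this; afterwards her own low good does. *)
- have mi := disjoint_unmatched dis.
  have fi := outcome_freeze_unmatched out mi.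
  rewrite /= iM /= in fi.
  have gain0 : 0 <= oapp (v i) 0 (gift i) by case: (gift i) => /=.
  have [fpos|fle] := ltP 0%E (freeze s i); last first.
    have {}f0 : freeze s i = 0%E by apply/le_anti; rewrite f0 fle.
    have f'0 := unfrozen_freeze f0 mi.
    apply: OnceFrozen => //; rewrite ?f'0 //; [exact: disjoint_step | by rewrite val; lra |].
    move=> j; have := lej j; rewrite f0 !val empty_s !mul0r !addr0.
    have := low_gain j dis; have := low_gain_self dis f0; lra.
  rewrite fpos in fi.
  apply: OnceFrozen; first by rewrite fi; apply: subr1_ge0e.
  + exact: disjoint_step.
  + by rewrite val; lra.
  + by rewrite fi; move: foo; case: (freeze s i) => //= foo _; apply: foo.
  + move=> j; have := lej j; rewrite !val empty_s mul0r addr0 fi.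
    have := low_gain j dis; have : 0 <= empty s' * l by rewrite mulr_ge0.
    move: f0 foo; case: (freeze s i) => [z||] //= _ foo.
      by rewrite intrD mulrDl /= mulN1r; lra.
    by rewrite foo // !mulr0; lra.
Qed.

Lemma match_invariant_efx t j g : match_invariant t -> pool t = set0 ->
    g \in bundles t j -> i != j ->
  bundle_value v i (bundles t j :\ g) <= 2 * value i t i.
Proof.
move=> inv pe gj ij; rewrite bundle_valueD1 //.
have := low_le g; have := bundle_value_ge0 i (bundles t i); have := hl0; have := hlh.
have [c ec] : exists c, #|bundles t j| = c.+1.
  by exists #|bundles t j :\ g|; rewrite (cardsD1 g) gj.
have e1 : empty t = 1 by rewrite pe eqxx.
have cardD1 u : (#|bundles t j| <= u.+1)%N ->
    value i t j - v i g <= u%:R * h.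
  move=> le_u; rewrite -bundle_valueD1 //.
  apply: le_trans (_ : #|bundles t j :\ g|%:R * h <= _).
    rewrite /bundle_value mulr_natl -sumr_const; apply: ler_sum => p _.
    by have [_ lh ->] := high_low; case: ifP => // _; apply: ltW.
  rewrite ler_wpM2r // ler_nat.
  by move: le_u; rewrite (cardsD1 g) gj.
case: inv => [u _ lei cardj|u r _ _ lei rival|f0 _ le_h foo lej].
- have : u%:R * h >= #|bundles t j|%:R * h.
    by rewrite ler_wpM2r ?ler_nat.
  by have := value_le_card j t; lra.
- rewrite e1 mul1r (natrS_mul r) in lei.
  have r0 : 0 <= r%:R * l by rewrite mulr_ge0.
  have u0 : 0 <= u%:R * h by rewrite mulr_ge0.
  case: (rival j) => [lev|_ cardj _|r1 lev].
  + by rewrite (natrS_mul r) in lev; lra.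
  + by have := cardD1 u cardj; lra.
  (* Without [g] the bundle of [j] is worth at most [u * h + (r + 1) * l], and [r >= 1] bounds this
     by twice [u * h + r * l]. *)
  + rewrite (natrS_mul r.+1) (natrS_mul r) in lev.
    have : l <= r%:R * l by rewrite ler_peMl // ler1n.
    by lra.
(* With the pool empty, [j] leads by at most [h], which is at most the value of the bundle of
   [i]. *)
- have := lej j; rewrite e1 mul1r.
  have : 0 <= (fine (freeze t i))%:~R * l.
    by rewrite mulr_ge0 // ler0z; case: (freeze t i) f0.
  by lra.
Qed.

End Matcher.

Lemma round_robin_invariant_efx i j g s : round_robin_invariant i s ->
    pool s = set0 -> g \in bundles s j ->
  bundle_value v i (bundles s j :\ g) <= 2 * value i s i.
Proof.
move=> [top _ [h1 _ h3]] pe gj; rewrite bundle_valueD1 //.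
have : v i top <= value i s i.
  (* The alternative, a full pool, contradicts [pe] because the good [g] exists. *)
  by case: h3 => //; rewrite pe => /setP /(_ g); rewrite !inE.
by have := h1 j; have := v_ge0 i g; lra.
Qed.

(** As the agents who freeze others are themselves never frozen, some agent
    takes part in every phase. *)
Definition some_active s : Prop :=
  (forall i, freeze s i = 0%E) \/
  exists i, in_M K i -> freeze s i = 0%E /\ [disjoint pool s & high_of K i].

Lemma unmatched_keeps_active mu gift s s' i :
    phase_outcome K pref mu gift s s' -> in_M K i -> freeze s i = 0%E ->
    mu i = None -> (forall p, p \in pool s -> p \in high_of K i ->
      exists j, mu j = Some p) ->
  freeze s' i = 0%E /\ [disjoint pool s' & high_of K i].
Proof.
move=> out iM f0 mi taken; split.
  by rewrite (outcome_freeze_unmatched out mi) /= f0 ltxx andbF.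
apply/pred0P => p /=; apply/negbTE/negP => /andP[ps' pH].
have ho := outcome_handout out.
have [j mj] := taken p (subsetP (handout_pool_sub ho) _ ps') pH.
by have := handout_gift_notin ho (outcome_matched out mj); rewrite ps'.
Qed.

(** The first time a counter becomes nonzero, an unmatched agent has set it; she has no high good
    left, is never matched again, and so keeps her own counter at 0. *)
Lemma some_active_step mu gift s s' :
  phase_outcome K pref mu gift s s' -> some_active s -> some_active s'.
Proof.
move=> out; have [mu_max _] := outcome_matching out.
have [[mu_in _] _] := mu_max.
case=> [f0|[i active]]; last first.
  right; exists i => iM; have [f0 dis] := active iM.
  have mi : mu i = None.
    case mi: (mu i) => [g|//]; have [_ gs gH] := mu_in _ _ mi.
    by rewrite (disjointFr dis gs) in gH.
  apply: (unmatched_keeps_active out iM f0 mi) => p ps.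
  by rewrite (disjointFr dis ps).
case: (boolP [forall i, freeze s' i == 0%E]) => [/forallP all0|].
  by left=> i; apply/eqP.
rewrite negb_forall => /existsP[j /eqP fj]; right.
case: (outcome_freeze_le out j) => [fj'|[i [g [iU mi _ _ _]]]].
  by case: fj; rewrite fj' /= f0 ltxx andbF.
exists i => iM; apply: (unmatched_keeps_active out iM (f0 i) mi) => p ps pH.
exact: (unmatched_high_taken mu_max iU mi ps pH).
Qed.

(** An agent who is not frozen receives a good, or the pool has been emptied. *)
Lemma some_active_progress mu gift s s' :
    phase_outcome K pref mu gift s s' -> some_active s -> pool s != set0 ->
  pool s' \proper pool s.
Proof.
move=> out active pn0; have ho := outcome_handout out.
have [i fi] : exists i, ~~ (in_M K i && (0 < freeze s i)%E).
  case: active => [f0|[i hi]]; first by exists (Ordinal n_gt0); rewrite f0 ltxx andbF.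
  by exists i; case: (boolP (in_M K i)) => //= /hi [-> _]; rewrite ltxx.
rewrite properE (handout_pool_sub ho) /=.
case gi: (gift i) => [g|].
  apply/subsetPn; exists g; last exact: handout_gift_notin ho gi.
  by have [_ _ hg _] := ho; apply: hg gi.
case: (outcome_served out gi) => [->|]; last by rewrite (negPf fi).
by rewrite subset0.
Qed.

(** * The combined invariant *)

Definition invariant s : Prop :=
  [/\ well_allocated s, some_active s &
    forall i, if K i is Some k then match_invariant i k s
              else round_robin_invariant i s].

Lemma invariant_init : invariant initial_state.
Proof.
split; first by split=> [g i|g]; rewrite ?inE //; left.
  by left.
move=> i; case Ki: (K i) => [k|]; first exact: match_invariant_init.
exact: round_robin_invariant_init.
Qed.

Lemma invariant_step mu gift s s' : phase_outcome K pref mu gift s s' ->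
  pool s != set0 -> invariant s -> invariant s'.
Proof.
move=> out pn0 [alloc active inv]; split.
- exact: well_allocated_handout alloc (outcome_handout out).
- exact: some_active_step out active.
- move=> i; have := inv i; case Ki: (K i) => [k|].
    exact: match_invariant_step Ki _ _ _ _ out alloc pn0.
  exact: round_robin_invariant_step out alloc Ki.
Qed.

Lemma invariant_final s : invariant s -> pool s = set0 ->
  is_allocation (bundles s) /\ is_EFX (1 / 2) v (bundles s).
Proof.
move=> [[alloc cover] _ inv] pe; split.
  split=> [i j ij|].
    apply/pred0P => g /=; apply/negbTE/negP => /andP[gi gj].
    by have [_ /(_ j gj) e] := alloc g i gi; rewrite e eqxx in ij.
  apply/setP => g; rewrite !inE; apply/bigcupP.
  by case: (cover g) => [|[i gi]]; [rewrite pe inE | exists i].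
move=> i j ij _ g gj.
suff : bundle_value v i (bundles s j :\ g) <= 2 * value i s i by lra.
have := inv i; case Ki: (K i) => [k|] invi.
  exact: (match_invariant_efx Ki invi pe gj ij).
exact: round_robin_invariant_efx invi pe gj.
Qed.

Hypothesis pref_linear : forall i, strict_linear_order (pref i).
Variable rr_order : seq 'I_n.
Hypothesis perm_rr : perm_eq rr_order (enum 'I_n).

(** Induction on the size of the pool, which every phase strictly decreases. *)
Lemma invariant_always_returns s : invariant s ->
  always_returns K pref rr_order
    (fun X => is_allocation X /\ is_EFX (1 / 2) v X) s.
Proof.
have [m] := ubnP #|pool s|; elim: m s => [//|m IH] s le_m inv.
have [pe|pn0] := eqVneq (pool s) set0.
  by apply: returns_now => //; apply: invariant_final.
apply: returns_later => // [|s' ph]; first exact: phase_exists.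
have [mu [gift out]] := phase_has_outcome perm_rr ph.
apply: IH; last exact: invariant_step out pn0 inv.
have [_ active _] := inv.
rewrite ltnS in le_m; apply: leq_trans le_m; apply: proper_card.
exact: some_active_progress out active pn0.
Qed.

End Invariant.

Theorem theorem5p1 (R : realType) :
  exists C : R,
  forall (n : nat) (G : finType) (v : 'I_n -> G -> R)
         (pref : 'I_n -> rel G) (rr_order : seq 'I_n),
    (2 <= n)%N -> (n <= #|G|)%N ->
    (forall i g, 0 <= v i g) ->
    bivalued v ->
    (forall i, strict_linear_order (pref i)) ->
    consistent_rankings v pref ->
    perm_eq rr_order (enum 'I_n) ->
    let (K, queries) := run v (initialization R pref) in
    (forall i, (queries_of i queries)%:R <= C * ln n%:R) /\
    always_returns K pref rr_order
      (fun X => is_allocation X /\ is_EFX (1 / 2) v X) initial_state.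
Proof.
exists (4 / ln 2) => n G v pref rr_order n_ge2 n_le v_ge0 biv lin cons perm_rr.
have := initialization_spec n_ge2 n_le biv lin cons.
case: (run v _) => K queries /= [few learnedK]; split=> //.
have n_gt0 : (0 < n)%N by lia.
exact: invariant_always_returns (invariant_init learnedK n_gt0 v_ge0).
Qed.
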